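(* Let $p_1,\dots,p_m$ be (not necessarily distinct) prime numbers and let $\mathbb{F}_1 = \prod_{i=2}^m\mathbb{Z}_{p_i}$. Then the lattice of all $(\mathbb{Z}_{p_1},\mathbb{F}_1)$-linearly closed clonoids is embedded in the lattice of all clones on $\prod_{i=1}^m\mathbb{Z}_{p_i}$ containing $\mathrm{Clo}(\prod_{i=1}^m\mathbb{Z}_{p_i},+)$; that is, there is an injective lattice homomorphism from the former lattice to the latter.
   Context: $\mathbb{N}=\{1,2,3,\dots\}$. A clone on a set $A$ is a set of finitary functions $A^n\to A$ ($n\in\mathbb{N}$) containing all projections and closed under composition. $\mathrm{Clo}(G,+)$ is the clone on $G$ generated by the addition of $G$. Clones are ordered by inclusion. Linearly closed clonoids: let $p$ be a prime and let $\mathbb{K}=\prod_{j\in J}\mathbb{Z}_{q_j}$ be a finite product of prime fields (for $J=\emptyset$, $\mathbb{K}$ is a one-element set). An element of $\mathbb{K}^n$ is written as $(\mathbf{x}_j)_{j\in J}$ with $\mathbf{x}_j\in\mathbb{Z}_{q_j}^n$. For a set $C$ of functions, $C^{[n]}$ denotes the set of its $n$-ary members. A $(\mathbb{Z}_p,\mathbb{K})$-linearly closed clonoid is a non-empty set $C$ of functions $f\colon\mathbb{K}^n\to\mathbb{Z}_p$ ($n\in\mathbb{N}$ arbitrary) such that: (1) for all $n\in\mathbb{N}$, $f,g\in C^{[n]}$ and $a,b\in\mathbb{Z}_p$, $af+bg\in C^{[n]}$; (2) for all $l,n\in\mathbb{N}$, $f\in C^{[n]}$ and matrices $A_j\in\mathbb{Z}_{q_j}^{n\times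 l}$ ($j\in J$), the function $\mathbb{K}^l\to\mathbb{Z}_p$, $(\mathbf{x}_j)_{j\in J}\mapsto f((A_j\cdot\mathbf{x}_j^t)_{j\in J})$ is in $C^{[l]}$. The set of all such clonoids, ordered by inclusion, is a lattice. *)

(* Defs.v *)
From HB Require Import structures.
From mathcomp Require Import all_boot all_order all_algebra.
From mathcomp Require Import boolp classical_sets.

Set Implicit Arguments.
Unset Strict Implicit.
Unset Printing Implicit Defensive.

Import Order.TTheory GRing.Theory.

Local Open Scope classical_set_scope.
Local Open Scope ring_scope.

(* The sets in a family closed under arbitrary intersections form a lattice under
   inclusion: meet is intersection, join is the closure of the union. *)
Section ClosureSystem.
Context {T : Type} {P : set (set T)}.

Definition closed_bigcap :=
  forall F : set (set T), F `<=` P -> P (\bigcap_(A in F) A).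

Definition closed_sets of closed_bigcap := {A : set T | A \in P}.

Context (PI : closed_bigcap).

HB.instance Definition _ := SubChoice.copy (closed_sets PI) {A : set T | A \in P}.
HB.instance Definition _ := [SubChoice_isSubPOrder of closed_sets PI by <: with set_display].

Lemma closed_smallest (F : set T) : smallest P F \in P.
Proof. by apply/mem_set/PI => A []. Qed.

Definition generated (F : set T) : closed_sets PI :=
  exist _ (smallest P F) (closed_smallest F).

Lemma closed_setI (A B : closed_sets PI) : val A `&` val B \in P.
Proof.
have -> : val A `&` val B = \bigcap_(X in [set val A; val B]) X.
  apply/seteqP; split=> [x [Ax Bx] X [|] ->//|x ABx].
  by split; apply: ABx; [left|right].
by apply/mem_set/PI => X [|] ->; apply/set_mem/valP.
Qed.

Definition closed_meet (A B : closed_sets PI) : closed_sets PI :=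
  exist _ (val A `&` val B) (closed_setI A B).

Definition closed_join (A B : closed_sets PI) : closed_sets PI :=
  generated (val A `|` val B).

Fact closed_meetP (A B C : closed_sets PI) :
  (A <= closed_meet B C)%O = (A <= B)%O && (A <= C)%O.
Proof. by rewrite -!Order.le_val /= -lexI. Qed.

Fact closed_joinP (A B C : closed_sets PI) :
  (closed_join A B <= C)%O = (A <= C)%O && (B <= C)%O.
Proof.
rewrite -!Order.le_val /= -leUx; apply/subsetPset/subsetPset.
  by apply: subset_trans; apply: sub_gen_smallest.
by apply: smallest_sub; apply/set_mem/valP.
Qed.

HB.instance Definition _ := Order.POrder_MeetJoin_isLattice.Build _
  (closed_sets PI) closed_meetP closed_joinP.

End ClosureSystem.

Section Upset.
Context {d : Order.disp_t} {L : latticeType d} (c : L).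

Definition upset := {x : L | (c <= x)%O}.

Fact upset_meet_closed (x y : L) :
  (c <= x -> c <= y -> c <= Order.meet x y)%O.
Proof. by rewrite lexI => -> ->. Qed.

Fact upset_join_closed (x y : L) :
  (c <= x -> c <= y -> c <= Order.join x y)%O.
Proof. by move=> cx _; apply: le_trans cx (leUl _ _). Qed.

HB.instance Definition _ := SubChoice.copy upset {x : L | (c <= x)%O}.
HB.instance Definition _ := Order.SubChoice_isSubLattice.Build d L [pred x : L | (c <= x)%O] d upset
  upset_meet_closed upset_join_closed.

End Upset.

(* Functions X n -> Y of all arities n >= 1; [X n] is meant to be an n-th power,
   and the first component of an element is its arity minus one. *)
Definition finitary (X : nat -> Type) (Y : Type) := {n : nat & X n.+1 -> Y}.

Definition of_arity {X : nat -> Type} {Y : Type} (C : set (finitary X Y)) (n : nat) :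
  set (X n.+1 -> Y) := [set f | C (existT _ n f)].
Arguments of_arity {X Y} C n _.

Section Clone.
Variable A : Type.

Definition operation := finitary (fun n => 'I_n -> A) A.

Definition is_clone (C : set operation) : Prop :=
  (forall n (i : 'I_n.+1), of_arity C n (fun x => x i)) /\
  (forall n l (f : ('I_n.+1 -> A) -> A) (g : 'I_n.+1 -> ('I_l.+1 -> A) -> A),
     of_arity C n f -> (forall i, of_arity C l (g i)) ->
     of_arity C l (fun x => f (fun i => g i x))).

Lemma is_clone_bigcap : closed_bigcap (P := is_clone).
Proof.
move=> F Fclone; split=> [n i C FC|n l f g Ff Fg C FC].
  by have [+ _] := Fclone C FC; apply.
have [_] := Fclone C FC; apply; first exact: Ff.
by move=> i; exact: Fg.
Qed.

Definition clone := closed_sets is_clone_bigcap.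
HB.instance Definition _ := Order.Lattice.on clone.

Definition Clo (F : set operation) : clone := generated is_clone_bigcap F.

End Clone.

(* The ring ['F_p] is Z/pZ only for p prime. *)
Section LinearlyClosedClonoid.
Context (p : nat) {J : finType} (q : J -> nat).

(* The n-th power of K = \prod_j Z_(q j), an element being given by its
   components x_j in Z_(q j)^n. *)
Definition Kpow (n : nat) := forall j : J, 'cV['F_(q j)]_n.

Definition is_lcclonoid (C : set (finitary Kpow 'F_p)) : Prop :=
  [/\ C !=set0,
      forall n (f g : Kpow n.+1 -> 'F_p) (a b : 'F_p),
        of_arity C n f -> of_arity C n g ->
        of_arity C n (fun x => a * f x + b * g x)
    & forall l n (f : Kpow n.+1 -> 'F_p) (A : forall j, 'M['F_(q j)]_(n.+1, l.+1)),
        of_arity C n f -> of_arity C l (fun x => f (fun j => A j *m x j))].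

(* Every linearly closed clonoid contains the zero functions, so an
   intersection of such clonoids is not empty. *)
Lemma lcclonoid0 C : is_lcclonoid C -> of_arity C 0 (fun=> 0).
Proof.
case=> -[[n f] Cf] Clin Cmx.
have := Clin _ _ _ 0 0 (Cmx 0%N _ _ (fun=> 0) Cf) (Cmx 0%N _ _ (fun=> 0) Cf).
by congr (of_arity C 0); apply/funext => x; rewrite !mul0r addr0.
Qed.

Lemma is_lcclonoid_bigcap : closed_bigcap (P := is_lcclonoid).
Proof.
move=> F FP; split.
- by exists (existT _ 0%N (fun=> 0)) => C /FP /lcclonoid0.
- by move=> n f g a b Ff Fg C FC; have [_ + _] := FP C FC; apply; [exact: Ff|exact: Fg].
- by move=> l n f A Ff C FC; have [_ _] := FP C FC; apply; exact: Ff.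
Qed.

Definition lcclonoid := closed_sets is_lcclonoid_bigcap.
HB.instance Definition _ := Order.Lattice.on lcclonoid.

End LinearlyClosedClonoid.

Section Product.
Context {I : finType} (p : I -> nat).

Definition Zprod := forall i : I, 'F_(p i).

Definition add_Zprod : operation Zprod :=
  existT _ 1%N (fun (x : 'I_2 -> Zprod) i => x ord0 i + x ord_max i).

Definition clone_above_add := upset (Clo [set add_Zprod]).
HB.instance Definition _ := Order.Lattice.on clone_above_add.

End Product.

(* Main.v *)
Require Import Defs.
From HB Require Import structures.
From mathcomp Require Import all_boot all_order all_algebra.
From mathcomp Require Import boolp classical_sets.

Set Implicit Arguments.
Unset Strict Implicit.
Unset Printing Implicit Defensive.

Import Order.TTheory GRing.Theory.

Local Open Scope classical_set_scope.
Local Open Scope ring_scope.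

(* A clonoid C is sent to the clone of all operations on the product whose first
   component is a linear form in the first coordinates plus c(x'), where c is in
   C and x' collects the other coordinates, and whose other components are linear
   forms in the matching coordinates.  Since c is recovered by setting the
   first coordinates to 0, the map reflects the order and preserves meets.  The
   join of C and D is C + D, and (l + c + d, A x') = (l + c, A x') + (d, 0) is
   obtained by adding members of the clones of C and D, so joins are preserved
   too. *)

(** * Dependent tuples with a head and a tail *)

Section DependentCons.
Context {m : nat} {T : 'I_m.+1 -> Type}.
Context (y0 : T ord0) (y : forall j, T (lift ord0 j)).

(** The type of the entry varies with [i], so the entry is transported along the equation supplied
    by [unliftP]. At a concrete index the cast disappears, because equality proofs between ordinals
    are unique. *)
Definition dcons (i : 'I_m.+1) : T i :=
  match unliftP ord0 i with
  | UnliftSome _ e => ecast i (T i) (esym e) (y _)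
  | UnliftNone e => ecast i (T i) (esym e) y0
  end.

Lemma dcons0 : dcons ord0 = y0.
Proof. by rewrite /dcons; case: unliftP => [//|e]; rewrite eq_axiomK. Qed.

Lemma dconsS j : dcons (lift ord0 j) = y j.
Proof.
rewrite /dcons; case: unliftP => [k e|//].
by have := lift_inj e => jk; move: e; case: _ / jk => e; rewrite eq_axiomK.
Qed.

End DependentCons.

Lemma lift0_ind m (P : 'I_m.+1 -> Prop) :
  P ord0 -> (forall j, P (lift ord0 j)) -> forall i, P i.
Proof. by move=> P0 PS i; case: (unliftP ord0 i) => [j|] ->. Qed.

Lemma clone_leP A (F G : clone A) : reflect (val F `<=` val G) (F <= G)%O.
Proof. by rewrite -Order.le_val; apply: subsetPset. Qed.

(** * Closure properties and joins of clonoids *)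

Section LinearlyClosedClonoid.
Context {p : nat} {J : finType} {q : J -> nat}.
Implicit Types C D : lcclonoid p q.

Lemma lcclonoid_leP C D : reflect (val C `<=` val D) (C <= D)%O.
Proof. by rewrite -Order.le_val; apply: subsetPset. Qed.

Lemma lcclonoidP C : is_lcclonoid (val C).
Proof. exact/set_mem/valP. Qed.

Lemma lcclonoid_lin C n (f g : Kpow q n.+1 -> 'F_p) (a b : 'F_p) :
  of_arity (val C) n f -> of_arity (val C) n g ->
  of_arity (val C) n (fun x => a * f x + b * g x).
Proof. by case: (lcclonoidP C) => _ + _; apply. Qed.

Lemma lcclonoid_mul C l n (f : Kpow q n.+1 -> 'F_p)
    (A : forall j, 'M['F_(q j)]_(n.+1, l.+1)) :
  of_arity (val C) n f -> of_arity (val C) l (fun x => f (fun j => A j *m x j)).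
Proof. by case: (lcclonoidP C) => _ _; apply. Qed.

Lemma lcclonoid_zero C n : of_arity (val C) n (fun=> 0).
Proof. exact: lcclonoid_mul (fun=> 0) (lcclonoid0 (lcclonoidP C)). Qed.

Lemma lcclonoidD C n (f g : Kpow q n.+1 -> 'F_p) :
  of_arity (val C) n f -> of_arity (val C) n g ->
  of_arity (val C) n (fun x => f x + g x).
Proof.
move=> Cf Cg; have := lcclonoid_lin 1 1 Cf Cg.
by congr (of_arity _ n); apply/funext => x; rewrite !mul1r.
Qed.

Lemma lcclonoid_sum C n (I : Type) (r : seq I) (a : I -> 'F_p)
    (f : I -> Kpow q n.+1 -> 'F_p) :
  (forall i, of_arity (val C) n (f i)) ->
  of_arity (val C) n (fun x => \sum_(i <- r) a i * f i x).
Proof.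
move=> Cf; elim: r => [|i r IHr].
  have := lcclonoid_zero C n.
  by congr (of_arity _ n); apply/funext => x; rewrite big_nil.
have := lcclonoid_lin (a i) 1 (Cf i) IHr.
by congr (of_arity _ n); apply/funext => x; rewrite big_cons mul1r.
Qed.

(** The sums [c + d] already form a clonoid, since linear combinations and matrix substitutions act
    on the two summands separately. It contains [C] and [D] because each of them has the zero
    functions. *)
Lemma lcclonoid_joinP C D n (f : Kpow q n.+1 -> 'F_p) :
  of_arity (val (C `|` D)%O) n f <->
  exists c d, [/\ of_arity (val C) n c, of_arity (val D) n d
                & f = fun x => c x + d x].
Proof.
have -> : val (C `|` D)%O = smallest (is_lcclonoid (q := q)) (val C `|` val D) by [].
split=> [|[c [d [Cc Dd ->]]]]; last first.
  by move=> A [[_ Alin _] CDA]; have := Alin _ _ _ 1 1 (CDA _ (or_introl Cc))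
    (CDA _ (or_intror Dd)); congr (A (existT _ n _)); apply/funext => x; rewrite !mul1r.
pose S : set (finitary (Kpow q) 'F_p) := [set h | exists c d,
  [/\ of_arity (val C) (projT1 h) c, of_arity (val D) (projT1 h) d
    & projT2 h = fun x => c x + d x]].
move=> /(_ S); apply; split; [split|].
- exists (existT _ 0%N (fun=> 0)), (fun=> 0), (fun=> 0).
  by split; [exact: lcclonoid_zero|exact: lcclonoid_zero|rewrite addr0].
- move=> l g h a b [c [d [Cc Dd /= ->]]] [c' [d' [Cc' Dd' /= ->]]].
  exists (fun x => a * c x + b * c' x), (fun x => a * d x + b * d' x).
  split; [exact: lcclonoid_lin|exact: lcclonoid_lin|].
  by apply/funext => x /=; rewrite !mulrDr addrACA.
- move=> l k g A [c [d [Cc Dd /= ->]]].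
  by exists (fun x => c (fun j => A j *m x j)), (fun x => d (fun j => A j *m x j));
    split=> //; exact: lcclonoid_mul.
- move=> [l h] [Ch|Dh].
    by exists h, (fun=> 0); split=> //=; [exact: lcclonoid_zero|
      apply/funext => x; rewrite addr0].
  by exists (fun=> 0), h; split=> //=; [exact: lcclonoid_zero|
    apply/funext => x; rewrite add0r].
Qed.

End LinearlyClosedClonoid.

(** * Operations with a linear part and a clonoid part *)

Section Embedding.
Context {m : nat} {p : 'I_m.+1 -> nat}.
Notation q := (fun j : 'I_m => p (lift ord0 j)).
Implicit Types C D : lcclonoid (p ord0) q.

Definition lower n (x : 'I_n -> Zprod p) : Kpow q n :=
  fun j => \col_k x k (lift ord0 j).

(** The section of [lower] with zero first coordinates: on its image every linear form in these
    coordinates vanishes. *)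
Definition raise n (y : Kpow q n) : 'I_n -> Zprod p :=
  fun k => dcons (T := fun i => 'F_(p i)) 0 (fun j => y j k 0).

Lemma raiseK n : cancel (@raise n) (@lower n).
Proof.
move=> y; apply/functional_extensionality_dep => j.
by apply/colP => k; rewrite mxE /raise dconsS.
Qed.

Definition linear_form n (i : 'I_m.+1) (a : 'I_n -> 'F_(p i))
  (x : 'I_n -> Zprod p) : 'F_(p i) := \sum_k a k * x k i.
Arguments linear_form {n} i a x.

Definition linear_plus n (a : forall i, 'I_n -> 'F_(p i))
    (c : Kpow q n -> 'F_(p ord0)) (x : 'I_n -> Zprod p) : Zprod p :=
  dcons (T := fun i => 'F_(p i)) (linear_form ord0 (a ord0) x + c (lower x))
        (fun j => linear_form (lift ord0 j) (a (lift ord0 j)) x).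

Lemma linear_plus0 n a c (x : 'I_n -> Zprod p) :
  linear_plus a c x ord0 = linear_form ord0 (a ord0) x + c (lower x).
Proof. exact: dcons0. Qed.

Lemma linear_plusS n a c (x : 'I_n -> Zprod p) j :
  linear_plus a c x (lift ord0 j) = linear_form (lift ord0 j) (a (lift ord0 j)) x.
Proof. exact: dconsS. Qed.

Lemma linear_plus_raise n a c (y : Kpow q n) :
  linear_plus a c (raise y) ord0 = c y.
Proof.
rewrite linear_plus0 raiseK /linear_form big1 ?add0r // => k _.
by rewrite /raise dcons0 mulr0.
Qed.

Lemma linear_plus_inj n a b c d :
  @linear_plus n a c = linear_plus b d -> c = d.
Proof.
by move=> abcd; apply/funext => y; rewrite -(linear_plus_raise a) abcd linear_plus_raise.
Qed.

Lemma linear_form_proj n i (k : 'I_n) x :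
  linear_form i (fun l => (l == k)%:R) x = x k i.
Proof.
rewrite /linear_form (bigD1 k) //= eqxx mul1r big1 ?addr0 // => l /negPf ->.
by rewrite mul0r.
Qed.

Lemma linear_plus_proj n (k : 'I_n) :
  linear_plus (fun _ l => (l == k)%:R) (fun=> 0) = (fun x => x k).
Proof.
apply/funext => x; apply/functional_extensionality_dep; apply: lift0_ind => [|j].
  by rewrite linear_plus0 linear_form_proj addr0.
by rewrite linear_plusS linear_form_proj.
Qed.

Lemma linear_plusD n a b c d :
  (fun x i => @linear_plus n a c x i + linear_plus b d x i) =
  linear_plus (fun i k => a i k + b i k) (fun y => c y + d y).
Proof.
have linD i x : linear_form i (a i) x + linear_form i (b i) x =
    linear_form i (fun k => a i k + b i k) x.
  by rewrite -big_split; apply: eq_bigr => k _; rewrite mulrDl.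
apply/funext => x; apply/functional_extensionality_dep; apply: lift0_ind => [|j].
  by rewrite !linear_plus0 addrACA linD.
by rewrite !linear_plusS linD.
Qed.

Lemma linear_form_comp n l i (a : 'I_n -> 'F_(p i)) (b : 'I_n -> 'I_l -> 'F_(p i)) x :
  \sum_k a k * linear_form i (b k) x =
  linear_form i (fun t => \sum_k a k * b k t) x.
Proof.
rewrite /linear_form; under eq_bigr do rewrite mulr_sumr.
rewrite exchange_big; apply: eq_bigr => t _; rewrite mulr_suml.
by apply: eq_bigr => k _; rewrite mulrA.
Qed.

(** The inner operations are purely linear outside the first component, so [c] only sees its
    argument multiplied by matrices. The parts [d k] reach the result only through the outer linear
    form in the first coordinates. *)
Lemma linear_plus_comp n l (a : forall i, 'I_n -> 'F_(p i)) c
    (b : 'I_n -> forall i, 'I_l -> 'F_(p i)) d :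
  (fun x => linear_plus a c (fun k => linear_plus (b k) (d k) x)) =
  linear_plus (fun i t => \sum_k a i k * b k i t)
    (fun y => \sum_k a ord0 k * d k y +
              c (fun j => (\matrix_(k, t) b k (lift ord0 j) t) *m y j)).
Proof.
apply/funext => x; apply/functional_extensionality_dep; apply: lift0_ind => [|j].
  rewrite !linear_plus0 addrA; congr (_ + c _).
    rewrite -linear_form_comp -big_split; apply: eq_bigr => k _ /=.
    by rewrite linear_plus0 mulrDr.
  apply/functional_extensionality_dep => j; apply/colP => k.
  by rewrite !mxE linear_plusS; apply: eq_bigr => t _; rewrite !mxE.
rewrite !linear_plusS -linear_form_comp; apply: eq_bigr => k _.
by rewrite linear_plusS.
Qed.

(** * The clone attached to a clonoid *)

Definition clonoid_operations C : set (operation (Zprod p)) :=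
  [set f | exists a c, of_arity (val C) (projT1 f) c /\ projT2 f = linear_plus a c].

(** By [linear_plus_inj] the clonoid part of an operation is unique, so membership does not depend
    on the coefficients [a]. *)
Lemma clonoid_operationsP C n c a :
  of_arity (clonoid_operations C) n (linear_plus a c) <-> of_arity (val C) n c.
Proof.
by split=> [[b [d [Cd /linear_plus_inj ->]]]//|Cc]; exists a, c.
Qed.

Lemma clonoid_operations_is_clone C : is_clone (clonoid_operations C).
Proof.
split=> [n k|n l f g [a [c [Cc /= ->]]] Cg].
  by rewrite -linear_plus_proj; apply/clonoid_operationsP; exact: lcclonoid_zero.
(* Coefficients and clonoid parts are chosen for all [g k] at once, so that [linear_plus_comp]
   applies. *)
have {Cg} /choice[bd Cbd] k : exists bd : (forall i, 'I_l.+1 -> 'F_(p i)) * _,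
    of_arity (val C) l bd.2 /\ g k = linear_plus bd.1 bd.2.
  by have [b [d Cbd]] := Cg k; exists (b, d).
have -> : g = fun k => linear_plus (bd k).1 (bd k).2.
  by apply/funext => k; have [_] := Cbd k.
rewrite linear_plus_comp; apply/clonoid_operationsP/lcclonoidD.
  by apply: lcclonoid_sum => k; have [] := Cbd k.
exact: lcclonoid_mul.
Qed.

Definition clonoid_clone C : clone (Zprod p) :=
  exist _ (clonoid_operations C) (mem_set (clonoid_operations_is_clone C)).

Lemma Clo_add_le C : (Clo [set add_Zprod p] <= clonoid_clone C)%O.
Proof.
apply/clone_leP; apply: smallest_sub; first exact: (clonoid_operations_is_clone C).
move=> _ ->; rewrite /add_Zprod.
(* Addition is the sum of the two binary projections, whose clonoid parts are zero. *)
have -> : (fun (x : 'I_2 -> Zprod p) i => x ord0 i + x ord_max i) =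
    (fun x i => linear_plus (fun _ l => (l == ord0)%:R) (fun=> 0) x i +
                linear_plus (fun _ l => (l == ord_max)%:R) (fun=> 0) x i).
  by rewrite !linear_plus_proj.
by rewrite linear_plusD; apply/clonoid_operationsP/lcclonoidD; apply: lcclonoid_zero.
Qed.

Definition clonoid_embedding C : clone_above_add p :=
  exist _ (clonoid_clone C) (Clo_add_le C).

(** * Order, meets and joins under the embedding *)

Lemma clonoid_clone_le C D : (clonoid_clone C <= clonoid_clone D)%O = (C <= D)%O.
Proof.
apply/clone_leP/lcclonoid_leP => [CD [n c] Cc|CD [n f] [a [c [Cc /= ->]]]].
  (* A member [c] of [C] is tested through the operation with zero coefficients and clonoid part
     [c]. *)
  by apply/(clonoid_operationsP D c (fun _ _ => 0))/CD/clonoid_operationsP.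
by apply/clonoid_operationsP/CD.
Qed.

Lemma clonoid_embedding_inj : injective clonoid_embedding.
Proof.
move=> C D /(congr1 val) /= CD.
by apply/le_anti; rewrite -!clonoid_clone_le CD lexx.
Qed.

Lemma clonoid_embedding_le : {homo clonoid_embedding : C D / (C <= D)%O}.
Proof. by move=> C D CD; rewrite -Order.le_val /= clonoid_clone_le. Qed.

Lemma clonoid_cloneI C D :
  clonoid_clone (C `&` D)%O = (clonoid_clone C `&` clonoid_clone D)%O.
Proof.
apply: val_inj; apply/seteqP; split=> [[n f] [a [c [[Cc Dc] /= ->]]]|[n f]].
  by split; apply/clonoid_operationsP.
(* The decomposition obtained from [C] also serves for [D]: uniqueness of the clonoid part puts the
   same [c] in [D]. *)
move=> [[a [c [Cc /= ->]]] /clonoid_operationsP Dc].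
by apply/clonoid_operationsP.
Qed.

Lemma clonoid_cloneU C D :
  clonoid_clone (C `|` D)%O = (clonoid_clone C `|` clonoid_clone D)%O.
Proof.
(* Monotonicity settles one inequality; the clone of the join must still be shown to lie below the
   join of the clones. *)
apply/le_anti; rewrite leUx !clonoid_clone_le leUl leUr !andbT.
apply/clone_leP => -[n f] [a [_ [/lcclonoid_joinP[c [d [Cc Dd ->]]] /= ->]]].
(* The whole linear part goes with [c], and [d] gets zero coefficients. *)
have -> : linear_plus a (fun y => c y + d y) =
    (fun x i => linear_plus a c x i + linear_plus (fun _ _ => 0) d x i).
  rewrite linear_plusD; congr (linear_plus _ _).
  by apply/functional_extensionality_dep => i; apply/funext => k; rewrite addr0.
pose M := (clonoid_clone C `|` clonoid_clone D)%O.
change (of_arity (val M) n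
  (fun x i => linear_plus a c x i + linear_plus (fun _ _ => 0) d x i)).
(* The sum is [add_Zprod] composed with its two summands; [1%N] encodes arity two, and the index
   [ord_max] falls in the [else] branch. *)
have [_ /(_ 1%N n (projT2 (add_Zprod p))
  (fun k => if k == ord0 then linear_plus a c else linear_plus (fun _ _ => 0) d))] :
  is_clone (val M) by exact/set_mem/valP.
apply.
  suff /clone_leP : (Clo [set add_Zprod p] <= M)%O.
    by apply; exact: sub_gen_smallest.
  exact: le_trans (Clo_add_le C) (leUl _ _).
move=> k; case: ifP => _.
  have /clone_leP : (clonoid_clone C <= M)%O by exact: leUl.
  by apply; apply/clonoid_operationsP.
have /clone_leP : (clonoid_clone D <= M)%O by exact: leUr.
by apply; apply/clonoid_operationsP.
Qed.

HB.instance Definition _ := Order.isOrderMorphism.Build _ _ _ _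
  clonoid_embedding clonoid_embedding_le.

Lemma clonoid_embeddingI : Order.meet_morphism clonoid_embedding.
Proof. by move=> C D; apply: val_inj; exact: clonoid_cloneI. Qed.

Lemma clonoid_embeddingU : Order.join_morphism clonoid_embedding.
Proof. by move=> C D; apply: val_inj; exact: clonoid_cloneU. Qed.

HB.instance Definition _ := Order.isLatticeMorphism.Build _ _ _ _
  clonoid_embedding clonoid_embeddingI clonoid_embeddingU.

End Embedding.

Theorem theorem1p3 (m : nat) (p : 'I_m.+1 -> nat)
    (p_prime : forall i : 'I_m.+1, prime (p i)) :
  exists phi : {lmorphism lcclonoid (p ord0) (fun i : 'I_m => p (lift ord0 i))
                          -> clone_above_add p},
    injective phi.
Proof. by exists clonoid_embedding; exact: clonoid_embedding_inj. Qed.
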